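(* Let $G=(V,E)$ be a finite, simple, connected undirected graph in which every edge carries exactly one label from a finite label set $L$, and let $H_i$ be a hedge of $G$. Then $$\sum_{v\in V(G)}d_L(v)\leq \sum_{v\in V(G/H_i)}d_L(v)+\sum_{v\in V(H_i)}d_L(v)-\mathrm{span}(H_i)\,\bigl(\delta_L(V(G))-1\bigr),$$ where $d_L$ is computed in $G$ for vertices of $G$ and in $G/H_i$ for vertices of $G/H_i$.
   Context: For each label $\ell_i$, the hedge $H_i$ is the set of edges carrying label $\ell_i$. $V(H_i)$ is the set of vertices incident with an edge of $H_i$, and $\mathrm{span}(H_i)$ is the number of connected components of $(V(H_i),H_i)$. $G/H_i$ is the graph obtained from $G$ in the following steps: 1. Contract every edge of $H_i$. 2. Delete the resulting loops with label $\ell_i$. Loops with other labels are kept. 3. Merge parallel edges with the same label between two vertices into one, and merge loops with the same label at a vertex into one. All remaining edges keep their labels. The label degree $d_L(v)$ of a vertex is the number of distinct labels on edges, including loops, incident with it. $\delta_L(V(G))$ is the minimum label degree over vertices of $G$. *)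

(* Defs.v *)
From HB Require Import structures.
From mathcomp Require Import all_boot all_order all_algebra.

Set Implicit Arguments.
Unset Strict Implicit.
Unset Printing Implicit Defensive.

(* Finite undirected multigraphs, loops allowed, with edges labelled in L.
   An edge has one end vertex if it is a loop and two otherwise. *)
Record lgraph (L : finType) := LGraph {
  vertex : finType;
  edge : finType;
  ends : edge -> {set vertex};
  label : edge -> L;
  card_ends : forall e, 0 < #|ends e| <= 2
}.

Arguments ends {L} l e.
Arguments label {L} l e.

Section LabelledGraphs.
Variables (L : finType) (G : lgraph L).

Definition is_loop (e : edge G) : bool := #|ends G e| == 1.

Definition simple_graph : Prop :=
  (forall e, ~~ is_loop e) /\ injective (ends G).

Definition adj : rel (vertex G) :=
  [rel u v | [exists e, ends G e == [set u; v]]].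

Definition connected_graph : Prop :=
  0 < #|vertex G| /\ forall u v, connect adj u v.

Definition hedge (l : L) : {set edge G} := [set e | label G e == l].

Definition hedge_vertices (l : L) : {set vertex G} :=
  [set v | [exists e in hedge l, v \in ends G e]].

Definition hedge_adj (l : L) : rel (vertex G) :=
  [rel u v | [exists e in hedge l, ends G e == [set u; v]]].

Definition hedge_span (l : L) : nat := n_comp (hedge_adj l) (hedge_vertices l).

Definition label_degree (v : vertex G) : nat :=
  #|[set label G e | e in [set e | v \in ends G e]]|.

(* #|L| bounds every label degree, so it is neutral for this minimum as soon
   as G has a vertex. *)
Definition min_label_degree : nat :=
  \big[minn/#|L|]_(v : vertex G) label_degree v.

End LabelledGraphs.

Section Contraction.
Variables (L : finType) (G : lgraph L) (l : L).

(* The vertices of the contracted graph are the classes of vertices of G joined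
   by edges of the hedge; a vertex outside the hedge is alone in its class. *)
Definition contract_class (v : vertex G) : {set vertex G} :=
  [set u | connect (hedge_adj l) v u].

Definition contract_vertex : finType :=
  {C : {set vertex G} | C \in [set contract_class v | v : vertex G]}.

Lemma contract_class_in (v : vertex G) :
  contract_class v \in [set contract_class u | u : vertex G].
Proof. exact: imset_f. Qed.

Definition contract_proj (v : vertex G) : contract_vertex :=
  exist _ (contract_class v) (contract_class_in v).

Lemma contract_card_ends (e : edge G) :
  0 < #|[set contract_proj v | v in ends G e]| <= 2.
Proof.
have /andP[ne0 le2] := card_ends e.
rewrite (leq_trans (leq_imset_card _ _) le2) andbT.
by move: ne0; rewrite !card_gt0 imset_eq0.
Qed.

(* All edges are kept; those of the hedge have become loops. *)
Definition contract_edges : lgraph L :=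
  LGraph (label G) contract_card_ends.

Definition delete_loops : lgraph L :=
  @LGraph L (vertex G) {e : edge G | ~~ (is_loop e && (label G e == l))}
    (fun e => ends G (val e)) (fun e => label G (val e))
    (fun e => card_ends (val e)).

Definition merged_edge : finType :=
  {x : {set vertex G} * L | x \in [set (ends G e, label G e) | e : edge G]}.

Lemma merged_card_ends (x : merged_edge) : 0 < #|(val x).1| <= 2.
Proof. by case: x => x /= /imsetP[e _ ->]; exact: card_ends. Qed.

Definition merge_parallel : lgraph L :=
  LGraph (fun x : merged_edge => (val x).2) merged_card_ends.

End Contraction.

Definition contract_hedge (L : finType) (G : lgraph L) (l : L) : lgraph L :=
  merge_parallel (delete_loops (contract_edges G l) l).

(* Main.v *)
Require Import Defs.
From mathcomp Require Import all_boot all_order all_algebra zify.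
Import Order.TTheory GRing.Theory Num.Theory.
Local Open Scope ring_scope.

(** Contracting a hedge costs a vertex at most the label of that hedge. A vertex
    outside [V(H)] is alone in its class and loses nothing; a component of [H]
    becomes a vertex of label degree at least [min_label_degree G - 1]. The
    vertices of [G/H] are indexed below by the roots of the components. *)

Section HedgeContraction.
Set Implicit Arguments.
Unset Strict Implicit.
Local Open Scope nat_scope.
Variables (L : finType) (G : lgraph L) (l : L).
Local Notation hadj := (@hedge_adj L G l).

Definition vertex_labels (H : lgraph L) (v : vertex H) : {set L} :=
  [set label H e | e in [set e | v \in ends H e]].

Lemma min_label_degree_le (v : vertex G) :
  min_label_degree G <= label_degree v.
Proof.
rewrite /min_label_degree; have := mem_index_enum v.
elim: (index_enum _) => // u s IHs; rewrite inE big_cons geq_min.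
by case/predU1P=> [<-|/IHs->]; rewrite ?leqnn ?orbT.
Qed.

Lemma hedge_adj_sym : symmetric hadj.
Proof. by move=> u v; apply: eq_existsb => e; rewrite setUC. Qed.

Lemma connect_hedge_sym : connect_sym hadj.
Proof. exact/sym_connect_sym/hedge_adj_sym. Qed.

Lemma connect_notin_hedge_vertices (u v : vertex G) :
  u \notin hedge_vertices G l -> connect hadj u v -> u = v.
Proof.
move=> uNH /connectP[[|w p] /=]; first by move=> _ ->.
case/andP=> /exists_inP[e el /eqP ends_e] _ _.
case/negP: uNH; rewrite inE; apply/exists_inP; exists e => //.
by rewrite ends_e !inE eqxx.
Qed.

Lemma roots_notin_hedge_vertices (v : vertex G) :
  v \notin hedge_vertices G l -> roots hadj v.
Proof.
by move=> vNH; apply/eqP/esym/(connect_notin_hedge_vertices vNH)/connect_root.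
Qed.

(** [v] lies in its own class, so equal classes make [u] and [v] connected; connected vertices share
    their root, and a root is its own. *)
Lemma contract_proj_inj_roots :
  {in roots hadj &, injective (@contract_proj L G l)}.
Proof.
move=> u v /eqP ru /eqP rv /(congr1 val)/= /setP/(_ v).
rewrite !inE connect0 => /(fingraph.rootP connect_hedge_sym).
by rewrite ru rv.
Qed.

(** An edge whose label is not [l] may become a loop, but it is not deleted; merging keeps a
    representative with the same ends and label. *)
Lemma vertex_labels_contract (v : vertex G) :
  vertex_labels v :\ l \subset
    @vertex_labels (contract_hedge G l) (contract_proj l v).
Proof.
apply/subsetP=> k /setD1P[kNl /imsetP[e]]; rewrite inE => ve k_e.
have keep_e : ~~ (@is_loop _ (contract_edges G l) e && (label G e == l)).
  by rewrite -k_e (negPf kNl) andbF.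
pose D := delete_loops (contract_edges G l) l.
pose e1 : edge D := exist _ e keep_e.
have e2P : (ends D e1, label D e1) \in
    [set (ends D e', label D e') | e' : edge D].
  exact: imset_f.
pose e2 : merged_edge D := Sub (ends D e1, label D e1) e2P.
apply/imsetP; exists (e2 : edge (contract_hedge G l)) => //.
by rewrite inE /=; apply: imset_f.
Qed.

Lemma label_degree_contract (v : vertex G) :
  label_degree v <=
    (@label_degree _ (contract_hedge G l) (contract_proj l v)).+1.
Proof.
have := subset_leq_card (vertex_labels_contract v).
have := cardsD1 l (vertex_labels v).
rewrite /label_degree /vertex_labels; case: (l \in _) => /=; lia.
Qed.

(** No edge at [v] carries [l], so removing [l] from its labels costs nothing. *)
Lemma label_degree_contract_notin (v : vertex G) :
  v \notin hedge_vertices G l ->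
  label_degree v <= @label_degree _ (contract_hedge G l) (contract_proj l v).
Proof.
move=> vNH; have lNv : l \notin vertex_labels v.
  apply: contra vNH => /imsetP[e]; rewrite inE => ve l_e.
  by rewrite inE; apply/exists_inP; exists e; rewrite ?inE -?l_e.
have := subset_leq_card (vertex_labels_contract v).
by have := cardsD1 l (vertex_labels v); rewrite (negPf lNv) add0n => <-.
Qed.

Lemma sum_label_degree_roots :
  \sum_(v | roots hadj v)
      @label_degree _ (contract_hedge G l) (contract_proj l v) <=
  \sum_(C : vertex (contract_hedge G l)) label_degree C.
Proof.
pose R := [set v | roots hadj v].
have injR : {in R &, injective (@contract_proj L G l)}.
  by move=> u v; rewrite !inE; apply: contract_proj_inj_roots.
rewrite (eq_bigl (fun v => v \in R)) => [|v]; last by rewrite inE.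
(* By injectivity the sum over roots becomes a sum over their classes, a part of the right-hand
   sum. *)
rewrite -(big_imset (fun C => @label_degree _ (contract_hedge G l) C) injR) /=.
rewrite [leqRHS](bigID (fun C => C \in contract_proj l @: R)) /=.
exact: leq_addr.
Qed.

(** The span term is moved to the right so that no truncated subtraction occurs. *)
Lemma sum_label_degree_contract :
  \sum_(v | v \notin hedge_vertices G l) label_degree v
    + hedge_span G l * min_label_degree G <=
  \sum_(C : vertex (contract_hedge G l)) label_degree C + hedge_span G l.
Proof.
apply: leq_trans (leq_add sum_label_degree_roots (leqnn _)).
rewrite [X in _ <= X + _](bigID (mem (hedge_vertices G l))) /=.
rewrite [leqLHS]addnC [leqRHS]addnAC leq_add //.
  (* The span counts the roots in V(H): each owes one minimum degree on the left and gets a 1 on the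
     right for the possible loss of [l]. *)
  rewrite /hedge_span /n_comp_mem -sum_nat_const -sum1_card.
  rewrite [X in _ <= _ + X](eq_bigl (fun v => roots hadj v
    && (v \in hedge_vertices G l))) // -big_split /=.
  apply: leq_sum => v _; rewrite addn1.
  exact: leq_trans (min_label_degree_le v) (label_degree_contract v).
(* Outside V(H) every vertex is a root. *)
rewrite [leqRHS](eq_bigl (fun v => v \notin hedge_vertices G l)) => [|v].
  by apply: leq_sum => v; apply: label_degree_contract_notin.
by apply: andb_idl; apply: roots_notin_hedge_vertices.
Qed.

End HedgeContraction.

Theorem theorem13 (L : finType) (G : lgraph L) (l : L)
  (simpleG : simple_graph G) (connG : connected_graph G) :
  (\sum_(v : vertex G) label_degree v)%N%:Z <=
    (\sum_(v : vertex (contract_hedge G l)) label_degree v)%N%:Z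
    + (\sum_(v in hedge_vertices G l) label_degree v)%N%:Z
    - (hedge_span G l)%:Z * ((min_label_degree G)%:Z - 1).
Proof.
have := sum_label_degree_contract G l.
(* The sum over V(H) now stands on both sides and cancels. *)
rewrite (bigID (mem (hedge_vertices G l)) predT) /=; nia.
Qed.
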